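(* Let $k\in\mathbb Z$, $k\ge0$, $\theta\in[0,1]$, $u_0\in C^{k,\theta}(\mathbb R)$, and let $u=u(x,t)\in C^\infty((-T,T):C^{k,\theta}(\mathbb R))$ be the corresponding local solution of the Benjamin-Bona-Mahony initial value problem $$\partial_t u+(1-\partial_x^2)^{-1}(\partial_x u+u\,\partial_x u)=0,\qquad u(x,0)=u_0(x),\quad x\in\mathbb R.$$ If there exist $t_0\in(-T,T)$ and $a,b\in\mathbb R$ with $a<b$ such that (i) $u(x,t_0)=-1$ for $x\in(a,b)$, and (ii) $\partial_tu(b,t_0)\ge\partial_tu(a,t_0)$, then $u(x,t)=-1$ for all $(x,t)\in\mathbb R\times(-T,T)$.
   Context: For $k\in\mathbb Z$, $k\ge0$, and $\theta\in[0,1]$, $C^{k,\theta}(\mathbb R)$ is the space of $f:\mathbb R\to\mathbb R$ of class $C^k$ with $f,f',\dots,f^{(k)}$ bounded and with finite norm $$\|f\|_{C^{k,\theta}}=\sum_{j=0}^k\|f^{(j)}\|_\infty+\sup_{h\ne0}\Big\|\frac{f^{(k)}(\cdot+h)-f^{(k)}(\cdot)}{|h|^\theta}\Big\|_\infty .$$ The nonlocal term is understood as $(1-\partial_x^2)^{-1}(\partial_xu+u\partial_xu)=\partial_x(1-\partial_x^2)^{-1}\big(u+\tfrac{u^2}{2}\big)$, where $\partial_x(1-\partial_x^2)^{-1}g=K*g$ with $K(x)=-\tfrac12\,\mathrm{sgn}(x)e^{-|x|}$. Local well-posedness: for every $u_0\in C^{k,\theta}(\mathbb R)$ there exist $T=T(\|u_0\|_{C^{k,\theta}})>0$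 and a unique solution $u\in C^\infty((-T,T):C^{k,\theta}(\mathbb R))$ of the initial value problem; the solution $u$ and the time $T$ in the claim are these. *)

(* Defs.v *)
From HB Require Import structures.
From mathcomp Require Import all_boot all_order all_algebra.
From mathcomp Require Import all_classical all_reals all_analysis.
Set Implicit Arguments.
Unset Strict Implicit.
Unset Printing Implicit Defensive.
Import Order.TTheory GRing.Theory Num.Theory.
Import numFieldNormedType.Exports.
Local Open Scope classical_set_scope.
Local Open Scope ring_scope.

Section holder_class.
Context {R : realType}.
Implicit Types (k : nat) (theta : R) (f g : R -> R).

(* The derivatives of order < k are continuous because they are derivable. *)
Definition class_C k f :=
  (forall j, (j < k)%N -> forall x, derivable (derive1n j f) x 1) /\
  continuous (derive1n k f).

Definition supnorm f : \bar R := ereal_sup [set `|f x|%:E | x in [set: R]].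

Definition holder_seminorm k theta f : \bar R :=
  ereal_sup [set supnorm (fun x => (derive1n k f (x + h) - derive1n k f x)
                                   / `|h| `^ theta)
            | h in [set h : R | h != 0]].

Definition holder_norm k theta f : \bar R :=
  (\sum_(0 <= j < k.+1) supnorm (derive1n j f) +
   holder_seminorm k theta f)%E.

Definition holder_class k theta : set (R -> R) :=
  [set f | [/\ class_C k f,
               forall j, (j <= k)%N -> bounded_fun (derive1n j f)
             & (holder_norm k theta f < +oo)%E]].

Definition holder_pred k theta : {pred R -> R} := mem (holder_class k theta).

Lemma supnorm_ge0 f : (0 <= supnorm f)%E.
Proof.
by apply: le_trans (ereal_sup_ubound _); last by exists 0.
Qed.

Lemma ler_supnorm f x : (`|f x|%:E <= supnorm f)%E.
Proof. by apply: ereal_sup_ubound; exists x. Qed.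

Lemma supnorm_comb a f g :
  (supnorm (fun x => a * f x + g x)%R <= `|a|%:E * supnorm f + supnorm g)%E.
Proof.
apply: ge_ereal_sup => _ [x _ <-].
apply: (@le_trans _ _ (`|a|%:E * `|f x|%:E + `|g x|%:E)%E).
  by rewrite -EFinM -EFinD lee_fin -normrM ler_normD.
by rewrite leeD ?ler_supnorm// lee_wpmul2l ?lee_fin ?ler_supnorm.
Qed.

Lemma class_C_comb k a f g : class_C k f -> class_C k g ->
  forall j, (j <= k)%N ->
    derive1n j (a *: f + g) = (fun x => a * derive1n j f x + derive1n j g x).
Proof.
move=> [df _] [dg _]; elim=> [//|j IH] jk.
rewrite derive1nS IH; last exact: ltnW.
apply/funext => x; rewrite derive1E.
have dfx := df _ jk x; have dgx := dg _ jk x.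
rewrite (_ : (fun y => _) = a *: derive1n j f + derive1n j g)//.
by rewrite deriveD// ?deriveZ//= -?derive1E//; exact: derivableZ.
Qed.

Lemma holder_seminorm_ge0 k theta f : (0 <= holder_seminorm k theta f)%E.
Proof.
apply: le_trans (supnorm_ge0 _) (ereal_sup_ubound _).
by exists 1 => //=; exact: oner_neq0.
Qed.

Lemma holder_norm_ge0 k theta f : (0 <= holder_norm k theta f)%E.
Proof.
apply: adde_ge0; last exact: holder_seminorm_ge0.
by apply: sume_ge0 => j _; exact: supnorm_ge0.
Qed.

Lemma le_supnorm_holder_norm k theta f j : (j <= k)%N ->
  (supnorm (derive1n j f) <= holder_norm k theta f)%E.
Proof.
move=> jk; rewrite /holder_norm.
rewrite (bigD1_seq j) ?mem_index_iota ?iota_uniq//= -addeA leeDl// adde_ge0//.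
  by apply: sume_ge0 => i _; exact: supnorm_ge0.
exact: holder_seminorm_ge0.
Qed.

Lemma holder_norm_comb k theta a f g : class_C k f -> class_C k g ->
  (holder_norm k theta (a *: f + g)%R <=
   `|a|%:E * holder_norm k theta f + holder_norm k theta g)%E.
Proof.
move=> cf cg; rewrite /holder_norm.
have sum0 (u : R -> R) :
    (0 <= \sum_(0 <= j < k.+1) supnorm (derive1n j u))%E.
  by apply: sume_ge0 => j _; exact: supnorm_ge0.
rewrite ge0_muleDr ?holder_seminorm_ge0// addeACA leeD//.
  rewrite ge0_sume_distrr; last by move=> j _; exact: supnorm_ge0.
  rewrite -big_split/= big_nat_cond [leRHS]big_nat_cond.
  apply: lee_sum => j; rewrite andbT ltnS => /andP[_ jk].
  by rewrite (class_C_comb a cf cg)//; exact: supnorm_comb.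
apply: ge_ereal_sup => _ [h h0 <-].
rewrite (class_C_comb a cf cg)//.
rewrite (_ : (fun x => _) = (fun x =>
    a * ((derive1n k f (x + h) - derive1n k f x) / `|h| `^ theta) +
        ((derive1n k g (x + h) - derive1n k g x) / `|h| `^ theta))); last first.
  by apply/funext => x; rewrite mulrA -mulrDl mulrBr opprD addrACA.
apply: le_trans (supnorm_comb _ _ _) _.
by rewrite leeD// ?lee_wpmul2l// ?lee_fin//;
  apply: ereal_sup_ubound; exists h.
Qed.

Lemma supnorm_bounded f : (supnorm f < +oo)%E -> bounded_fun f.
Proof.
move=> foo; have ffin : supnorm f \is a fin_num.
  by rewrite ge0_fin_numE ?supnorm_ge0.
exists (fine (supnorm f)); split; first exact: num_real.
move=> M /ltW fM x _ /=; apply: le_trans fM.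
by rewrite -lee_fin fineK// ler_supnorm.
Qed.

Lemma derive1n_zero j : derive1n j (0 : R -> R) = 0.
Proof.
elim: j => [//|j IH]; rewrite derive1nS IH; apply/funext => x.
by rewrite (_ : 0 = cst 0)// derive1_cst.
Qed.

Lemma supnorm0 : supnorm 0 = 0%E.
Proof.
apply/eqP; rewrite eq_le supnorm_ge0 andbT; apply: ge_ereal_sup => _ [x _ <-].
by rewrite normr0.
Qed.

Lemma holder_norm0 k theta : holder_norm k theta 0 = 0%E.
Proof.
rewrite /holder_norm big1 ?add0e; last first.
  by move=> j _; rewrite derive1n_zero supnorm0.
apply/eqP; rewrite eq_le holder_seminorm_ge0 andbT.
apply: ge_ereal_sup => _ [h _ <-].
rewrite derive1n_zero (_ : (fun x => _) = 0) ?supnorm0//.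
by apply/funext => x; rewrite subrr mul0r.
Qed.

Lemma holder_class0 k theta : holder_class k theta 0.
Proof.
split.
- split; last by rewrite derive1n_zero; exact: cst_continuous.
  by move=> j _ x; rewrite derive1n_zero; exact: derivable_cst.
- by move=> j _; rewrite derive1n_zero; apply: supnorm_bounded; rewrite supnorm0.
- by rewrite holder_norm0.
Qed.

Lemma holder_class_submod k theta : submod_closed (holder_pred k theta).
Proof.
split; first by rewrite inE; exact: holder_class0.
move=> a f g; rewrite !inE => -[cf bf nf] [cg bg ng].
have nfg : (holder_norm k theta (a *: f + g)%R < +oo)%E.
  apply: le_lt_trans (holder_norm_comb _ _ cf cg) _.
  by rewrite lte_add_pinfty// lte_mul_pinfty.
split=> //.
- split; last first.
    rewrite (class_C_comb a cf cg)// => x.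
    by apply: cvgD; [apply: cvgMr; exact: cf.2|exact: cg.2].
  move=> j jk x; rewrite (class_C_comb a cf cg) ?(ltnW jk)//.
  rewrite (_ : (fun y => _) = a *: derive1n j f + derive1n j g)//.
  by apply: derivableD; [apply: derivableZ; exact: cf.1|exact: cg.1].
- move=> j jk; apply: supnorm_bounded; apply: le_lt_trans nfg.
  exact: le_supnorm_holder_norm.
Qed.

End holder_class.

Section holder_space.
Variables (R : realType) (k : nat) (theta : R).

HB.instance Definition _ := GRing.isSubmodClosed.Build R (R -> R) (holder_pred k theta)
  (@holder_class_submod R k theta).

Record holder_space := HolderSpace {
  holder_fun :> R -> R;
  holder_funP : holder_fun \in holder_pred k theta }.

HB.instance Definition _ := [isSub for holder_fun].
HB.instance Definition _ := [Choice of holder_space by <:].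
HB.instance Definition _ := [SubChoice_isSubLmodule of holder_space by <:].

(* Only used to build the normed module: it is the norm `|f| of holder_space,
   see [holder_normrE]. *)
Definition holder_space_norm (f : holder_space) : R :=
  fine (holder_norm k theta f).

Lemma holder_space_class (f : holder_space) : holder_class k theta f.
Proof. exact: set_mem (holder_funP f). Qed.

Lemma holder_space_normE (f : holder_space) :
  (holder_space_norm f)%:E = holder_norm k theta f.
Proof.
have [_ _ nf] := holder_space_class f.
by rewrite fineK// ge0_fin_numE// holder_norm_ge0.
Qed.

Lemma holder_space_norm0 : holder_space_norm 0 = 0.
Proof.
rewrite /holder_space_norm [holder_fun 0](_ : _ = 0)//.
by rewrite holder_norm0.
Qed.

Lemma holder_space_norm_comb (a : R) (f g : holder_space) :
  holder_space_norm (a *: f + g) <=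
  `|a| * holder_space_norm f + holder_space_norm g.
Proof.
have [[cf _ _] [cg _ _]] := (holder_space_class f, holder_space_class g).
rewrite -lee_fin EFinD EFinM !holder_space_normE.
exact: holder_norm_comb.
Qed.

Lemma ler_holder_space_normD (f g : holder_space) :
  holder_space_norm (f + g) <= holder_space_norm f + holder_space_norm g.
Proof.
by have := holder_space_norm_comb 1 f g; rewrite scale1r normr1 mul1r.
Qed.

Lemma holder_space_normZ (a : R) (f : holder_space) :
  holder_space_norm (a *: f) = `|a| * holder_space_norm f.
Proof.
have le_normZ b g : holder_space_norm (b *: g) <= `|b| * holder_space_norm g.
  by have := holder_space_norm_comb b g 0; rewrite !addr0 holder_space_norm0 addr0.
have [->|a0] := eqVneq a 0; first by rewrite scale0r holder_space_norm0 normr0 mul0r.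
apply/eqP; rewrite eq_le le_normZ/= -ler_pdivlMl ?normr_gt0// -normfV.
by rewrite -[in leLHS](scalerK a0 f) le_normZ.
Qed.

Lemma holder_space_norm_eq0 (f : holder_space) :
  holder_space_norm f = 0 -> f = 0.
Proof.
move=> f0; apply: val_inj; apply/funext => x /=.
apply/eqP; rewrite -normr_le0 -lee_fin -f0 holder_space_normE.
exact: le_trans (ler_supnorm _ _) (le_supnorm_holder_norm _ _ (leq0n k)).
Qed.

HB.instance Definition _ := Lmodule_isNormed.Build R holder_space
  ler_holder_space_normD holder_space_normZ holder_space_norm_eq0.

Lemma holder_normrE (f : holder_space) : (`|f|)%:E = holder_norm k theta f.
Proof. exact: holder_space_normE. Qed.

End holder_space.

Section BBM.
Context {R : realType}.

Definition convolution (f g : R -> R) (x : R) : R :=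
  \int[lebesgue_measure]_(y in [set: R]) (f (x - y) * g y).

(* Convolution with this kernel is d/dx (1 - d^2/dx^2)^-1 on bounded continuous
   functions. *)
Definition BBM_kernel (x : R) : R := - (1 / 2) * Num.sg x * expR (- `|x|).

(* Derivatives are taken in the normed module V; on an open set I they only
   depend on the values of u on I. *)
Definition smooth_on (V : normedModType R) (I : set R) (u : R -> V) :=
  forall n t, I t -> derivable (derive1n n u) t 1.

(* The nonlocal term (1 - d^2/dx^2)^-1 (u_x + u u_x) is read as
   d/dx (1 - d^2/dx^2)^-1 (u + u^2/2), which needs no space derivative of u. *)
Definition BBM_solution k (theta : R) (I : set R) (u0 : holder_space k theta)
    (u : R -> holder_space k theta) :=
  [/\ smooth_on I u, u 0 = u0 &
      forall t, I t -> forall x,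
        derive1 (fun s => u s x) t +
        convolution BBM_kernel (fun y => u t y + u t y ^+ 2 / 2) x = 0].

End BBM.

(* Main.v *)
Require Import Defs.
From mathcomp Require Import all_boot all_order all_algebra.
From mathcomp Require Import all_classical all_reals all_analysis.
From mathcomp Require Import measurable_realfun lra ring.
Import Order.TTheory GRing.Theory Num.Theory.
Import numFieldNormedType.Exports.
Local Open Scope classical_set_scope.
Local Open Scope ring_scope.

(* Write K for the kernel of d/dx (1 - d^2/dx^2)^-1 and v = (u(t0) + 1)^2 / 2.
   Since u + u^2/2 = v - 1/2 at time t0 and K is odd, the equation reads
   u_t(x, t0) = - (K * v)(x), so (ii) says (K * v)(b) <= (K * v)(a). The
   function y |-> K(b - y) - K(a - y) is positive outside [a, b], while v >= 0
   vanishes on [a, b] by (i); hence the integral of (K(b - y) - K(a - y)) v(y)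
   is both nonnegative and nonpositive, and v = 0, i.e. u(t0) = -1 everywhere.
   The set of times at which u = -1 everywhere is closed by continuity, and open
   because |u_t| <= sup |u + 1|^2 / 2; it is therefore the whole of (-T, T). *)

(** * Mass, mean and convolution bounds of the kernel K *)

Section kernel.
Context {R : realType}.
Notation mu := (@lebesgue_measure R).

(** Each half of [BBM_kernel] is an exponential tail of mass 1, up to the factor 1/2 and a sign; an
    antiderivative is [- expR (x - y)]. *)
Lemma integral_expR_right (x : R) :
  (\int[mu]_(y in `]x, +oo[) (expR (x - y))%:E = 1)%E.
Proof.
have ce : continuous (fun y : R => expR (x - y)).
  move=> y; apply: continuous_comp; last exact: continuous_expR.
  by apply: cvgB; [exact: cvg_cst|exact: cvg_id].
have dF (y : R) : is_derive y 1 (fun z : R => - expR (x - z)) (expR (x - y)).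
  by apply: is_derive_eq; rewrite /GRing.scale/=; ring.
rewrite integral_itv_obnd_cbnd; last first.
  apply/measurable_EFinP; apply: measurable_funTS.
  exact: continuous_measurable_fun.
rewrite (@ge0_continuous_FTC2y _ _ (fun y => - expR (x - y)) x 0).
- by rewrite subrr expR0 EFinN oppeK add0e.
- by move=> y _; exact: expR_ge0.
- exact: continuous_subspaceT.
- rewrite -oppr0; apply: cvgN.
  under eq_fun do rewrite expRD.
  rewrite -(mulr0 (expR x)).
  by apply: cvgM; [exact: cvg_cst|exact: cvgr_expR].
- by move=> y _; case: (dF y).
- by apply: cvgN; apply: cvg_at_right_filter; exact: ce.
- by move=> y _; rewrite derive1E; case: (dF y).
Qed.

(** The reflection of [y] into [- y] reduces this to the right tail starting at [- x]. *)
Lemma integral_expR_left (x : R) :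
  (\int[mu]_(y in `]-oo, x[) (expR (y - x))%:E = 1)%E.
Proof.
have ce : continuous (fun y : R => expR (y - x)).
  move=> y; apply: continuous_comp; last exact: continuous_expR.
  by apply: cvgB; [exact: cvg_id|exact: cvg_cst].
have me : measurable_fun setT (fun y : R => expR (y - x)).
  exact: continuous_measurable_fun.
rewrite integral_itv_bndo_bndc; last first.
  by apply/measurable_EFinP; apply: measurable_funTS.
rewrite -[x in X in integral _ X _](opprK x).
rewrite ge0_integration_by_substitutionNy//.
- rewrite -integral_itv_obnd_cbnd; last first.
    apply/measurable_EFinP; apply: measurable_funTS.
    by apply: measurableT_comp => //; exact: measurableT_comp.
  rewrite -[RHS](integral_expR_right (- x)); apply: eq_integral => y _ /=.
  by rewrite addrC.
- exact: continuous_subspaceT.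
Qed.

Lemma BBM_kernel_lt0 (x : R) : x < 0 -> BBM_kernel x = expR x / 2.
Proof. by move=> x0; rewrite /BBM_kernel ltr0_sg// ltr0_norm// opprK; lra. Qed.

Lemma BBM_kernel_gt0 (x : R) : 0 < x -> BBM_kernel x = - (expR (- x) / 2).
Proof. by move=> x0; rewrite /BBM_kernel gtr0_sg// gtr0_norm//; lra. Qed.

(** K jumps at 0, so continuity does not apply; the piecewise exponential form does. *)
Lemma measurable_BBM_kernel : measurable_fun setT (@BBM_kernel R).
Proof.
rewrite (_ : BBM_kernel = fun x => if x < 0 then expR x / 2
    else if 0 < x then - (expR (- x) / 2) else 0).
  have m2 : measurable_fun setT (fun x : R => expR x / 2).
    by apply: measurable_funM => //; exact: measurable_cst.
  apply: measurable_fun_ifT => //; first exact: measurable_fun_ltr.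
  apply: measurable_fun_ifT => //; first exact: measurable_fun_ltr.
  apply: measurableT_comp => //.
  by apply: (measurableT_comp m2).
apply/funext => x; case: (ltgtP x 0) => [/BBM_kernel_lt0|/BBM_kernel_gt0|->]//.
by rewrite /BBM_kernel sgr0 mulr0 mul0r.
Qed.

Lemma measurable_BBM_kernel_shift (x : R) :
  measurable_fun setT (fun y : R => BBM_kernel (x - y)).
Proof.
apply: (measurableT_comp measurable_BBM_kernel).
by apply: measurable_funB => //; exact: measurable_cst.
Qed.

Lemma setT_itv_split (x : R) :
  [set: R] = [set` `]-oo, x]] `|` [set` `]x, +oo[].
Proof.
apply/esym/seteqP; split=> // y _ /=; rewrite !in_itv/= andbT.
by case: leP; [left|right].
Qed.

Lemma disj_itv_split (x : R) : [disjoint [set` `]-oo, x]] & [set` `]x, +oo[]].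
Proof.
apply/disj_setPS => y /=; rewrite !in_itv/= andbT => -[yx xy].
by move: (le_lt_trans yx xy); rewrite ltxx.
Qed.

Lemma integral_norm_BBM_kernel (x : R) :
  (\int[mu]_y `|BBM_kernel (x - y)|%:E = 1)%E.
Proof.
have mK := measurable_BBM_kernel_shift x.
have mnK D : measurable_fun D (fun y : R => `|BBM_kernel (x - y)|%:E).
  by apply: measurable_funTS; apply/measurable_EFinP; exact: measurableT_comp.
rewrite (setT_itv_split x) ge0_integral_setU//=; last 2 first.
  exact: mnK.
  exact: disj_itv_split.
(* Dropping the null endpoint [x] gives [x - y] a strict sign on each half. *)
rewrite -integral_itv_bndo_bndc//.
rewrite (eq_integral (fun y : measurableTypeR R =>
    (2^-1)%:E * (expR (y - x))%:E)%E); last first.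
  move=> y; rewrite inE/= in_itv/= => yx.
  rewrite BBM_kernel_gt0 ?subr_gt0// normrN ger0_norm ?divr_ge0 ?expR_ge0//.
  by rewrite opprB -EFinM mulrC.
rewrite [X in (_ + X)%E](eq_integral (fun y : measurableTypeR R =>
    (2^-1)%:E * (expR (x - y))%:E)%E); last first.
  move=> y; rewrite inE/= in_itv/= andbT => xy.
  rewrite BBM_kernel_lt0 ?subr_lt0// ger0_norm ?divr_ge0 ?expR_ge0//.
  by rewrite -EFinM mulrC.
have me D (g : R -> R) : continuous g ->
    measurable_fun D (fun y : R => (expR (g y))%:E).
  move=> cg; apply: measurable_funTS; apply/measurable_EFinP.
  by apply: measurableT_comp => //; exact: continuous_measurable_fun.
rewrite !ge0_integralZl//=; last 2 first.
- by apply: (me _ (fun y => x - y)) => y;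
  apply: cvgB; [exact: cvg_cst|exact: cvg_id].
- by apply: (me _ (fun y => y - x)) => y;
  apply: cvgB; [exact: cvg_id|exact: cvg_cst].
rewrite integral_expR_left integral_expR_right !mule1 -EFinD.
by congr EFin; lra.
Qed.

Lemma integrable_BBM_kernel (x : R) :
  mu.-integrable setT (EFin \o (fun y : R => BBM_kernel (x - y))).
Proof.
apply/integrableP; split.
  by apply/measurable_EFinP; exact: measurable_BBM_kernel_shift.
by rewrite /= integral_norm_BBM_kernel ltry.
Qed.

(** K is odd: the halves contribute -1/2 and 1/2. Hence adding a constant to a bounded continuous
    function does not change its convolution with K. *)
Lemma Rintegral_BBM_kernel (x : R) :
  \int[mu]_y BBM_kernel (x - y) = 0.
Proof.
have iK := integrable_BBM_kernel x.
have iKS (i : interval R) :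
    mu.-integrable [set` i] (EFin \o (fun y : R => BBM_kernel (x - y))).
  by apply: integrableS iK.
rewrite (setT_itv_split x) Rintegral_setU//; last 2 first.
  by rewrite -setT_itv_split.
  exact: disj_itv_split.
rewrite -Rintegral_itv_bndo_bndc//.
have ie (i : interval R) (g : R -> R) :
    (\int[mu]_(y in [set` i]) (expR (g y))%:E = 1)%E ->
    continuous g ->
    mu.-integrable [set` i] (EFin \o (fun y : R => expR (g y))).
  move=> i1 cg; apply/integrableP; split.
    apply: measurable_funTS; apply/measurable_EFinP.
    by apply: measurableT_comp => //; exact: continuous_measurable_fun.
  by under eq_integral do rewrite /= ger0_norm ?expR_ge0//; rewrite i1 ltry.
rewrite (@eq_Rintegral _ _ _ _ _ (fun y : measurableTypeR R =>
    - 2^-1 * expR (y - x))); last first.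
  move=> y; rewrite inE/= in_itv/= => yx.
  by rewrite BBM_kernel_gt0 ?subr_gt0// opprB mulrC mulNr.
rewrite [X in _ + X](@eq_Rintegral _ _ _ _ _ (fun y : measurableTypeR R =>
    2^-1 * expR (x - y))); last first.
  move=> y; rewrite inE/= in_itv/= andbT => xy.
  by rewrite BBM_kernel_lt0 ?subr_lt0// mulrC.
rewrite !RintegralZl//; first last.
- apply: (ie _ (fun y => y - x)); first exact: integral_expR_left.
  by move=> y; apply: cvgB; [exact: cvg_id|exact: cvg_cst].
- apply: (ie _ (fun y => x - y)); first exact: integral_expR_right.
  by move=> y; apply: cvgB; [exact: cvg_cst|exact: cvg_id].
by rewrite /Rintegral integral_expR_left integral_expR_right; lra.
Qed.

Lemma integrable_BBM_kernelM (x M : R) (f : R -> R) : continuous f ->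
  (forall y, `|f y| <= M) ->
  mu.-integrable setT (EFin \o (fun y : R => BBM_kernel (x - y) * f y)).
Proof.
move=> cf fM.
apply: eq_integrable (integrableMl _ (integrable_BBM_kernel x)
  (continuous_measurable_fun cf) _) => //.
exists M; split; first exact: num_real.
by move=> N MN y _; apply: le_trans (fM y) (ltW MN).
Qed.

(** Young's inequality between L^1 and L^oo, with constant 1 because K has L^1 norm 1. *)
Lemma normr_convolution_BBM_kernel (x M : R) (f : R -> R) : continuous f ->
  (forall y, `|f y| <= M) -> `|convolution BBM_kernel f x| <= M.
Proof.
move=> cf fM; have iKf := integrable_BBM_kernelM x M f cf fM.
have inK := integrable_norm (integrable_BBM_kernel x).
apply: (le_trans (le_normr_Rintegral _ iKf)) => //.
apply: (@le_trans _ _ (\int[mu]_y (M * `|BBM_kernel (x - y)|))).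
  apply: le_Rintegral => //.
  - exact: integrable_norm.
  - by apply: eq_integrable (integrableZl _ M inK) => //.
  - by move=> y _; rewrite normrM mulrC ler_wpM2r.
rewrite RintegralZl// /Rintegral integral_norm_BBM_kernel//= mulr1//.
Qed.

End kernel.

(** * From the two conditions at a single time to vanishing on the whole line *)

Section unique_continuation.
Context {R : realType}.
Notation mu := (@lebesgue_measure R).

(** The endpoint values are one-sided limits from inside. The closed interval matters because the
    kernel comparison below holds only strictly outside it. *)
Lemma continuous_eq_cst_itv (f : R -> R) (a b c : R) : a < b -> continuous f ->
  (forall x, a < x < b -> f x = c) -> forall x, a <= x <= b -> f x = c.
Proof.
move=> ab cf fc x /andP[]; rewrite !le_eqVlt.
have fl : f a = c.
  apply: (@cvg_unique _ _ (f y @[y --> a^'+])) => //.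
    exact/cvg_at_right_filter/cf.
  apply: cvg_near_cst; near=> y; apply: fc; apply/andP; split; near: y.
    exact: nbhs_right_gt.
  exact: nbhs_right_lt.
have fr : f b = c.
  apply: (@cvg_unique _ _ (f y @[y --> b^'-])) => //.
    exact/cvg_at_left_filter/cf.
  apply: cvg_near_cst; near=> y; apply: fc; apply/andP; split; near: y.
    exact: nbhs_left_gt.
  exact: nbhs_left_lt.
by move=> /predU1P[<-//|ax] /predU1P[->//|xb]; apply: fc; rewrite ax.
Unshelve. all: by end_near. Qed.

(** K is strictly increasing on each side of its jump at 0, and [a - y] and [b - y] lie on the same
    side. For [y] in [a, b] the jump reverses the inequality. *)
Lemma BBM_kernel_lt (a b y : R) : a < b -> y < a \/ b < y ->
  BBM_kernel (a - y) < BBM_kernel (b - y).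
Proof.
move=> ab [ya|yb].
  have yb := lt_trans ya ab.
  rewrite !BBM_kernel_gt0 ?subr_gt0// ltrN2 ltr_pM2r ?invr_gt0// ltr_expR.
  lra.
have ya := lt_trans ab yb.
by rewrite !BBM_kernel_lt0 ?subr_lt0// ltr_pM2r ?invr_gt0// ltr_expR; lra.
Qed.

(** A point of [A] would bring an interval of length 2e > 0 with it. *)
Lemma negligible_open_empty (A : set R) :
  open A -> mu.-negligible A -> A = set0.
Proof.
move=> oA nA; apply/seteqP; split=> // x Ax.
have /nbhs_ballP[e /= e0 xeA] : nbhs x A by exact: open_nbhs_nbhs.
have : mu.-negligible `]x - e, x + e[.
  apply: negligibleS nA => y /=; rewrite in_itv/= => xey; apply: xeA.
  by rewrite /ball/= ltr_distlC.
move=> nI; have mu0 : mu `]x - e, x + e[ = 0%E.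
  exact: (@measure_negligible _ _ R mu _ (measurable_itv _) nI).
have := etrans (esym mu0) (lebesgue_measure_itv `]x - e, x + e[).
by rewrite /= lte_fin ifT; [rewrite -EFinB => -[]; lra|lra].
Qed.

Lemma eq0_convolution_BBM_kernel (a b M : R) (v : R -> R) : a < b ->
  continuous v -> (forall x, 0 <= v x <= M) ->
  (forall x, a < x < b -> v x = 0) ->
  convolution BBM_kernel v b <= convolution BBM_kernel v a ->
  forall x, v x = 0.
Proof.
move=> ab cv v0M v0 vba.
have vab := continuous_eq_cst_itv v a b 0 ab cv v0.
have vM y : `|v y| <= M by case/andP: (v0M y) => v_ge0 vM; rewrite ger0_norm.
(* [D] is nonnegative everywhere, while [vba] makes its integral nonpositive. *)
pose D (y : R) := BBM_kernel (b - y) * v y - BBM_kernel (a - y) * v y.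
have iD : mu.-integrable setT (EFin \o D).
  have iab := integrableB measurableT (integrable_BBM_kernelM b M v cv vM)
    (integrable_BBM_kernelM a M v cv vM).
  exact: eq_integrable iab.
have out y : ~~ (a <= y <= b) -> y < a \/ b < y.
  by rewrite negb_and -!ltNge => /orP.
have D_ge0 y : 0 <= D y.
  rewrite /D -mulrBl; have [/vab->|/out yab] := boolP (a <= y <= b).
    by rewrite mulr0.
  apply: mulr_ge0; last by case/andP: (v0M y).
  by rewrite subr_ge0; apply/ltW/BBM_kernel_lt.
have D0 : (\int[mu]_y `|(D y)%:E| = 0)%E.
  rewrite (eq_integral (fun y : measurableTypeR R => (D y)%:E)); last first.
    by move=> y _ /=; rewrite ger0_norm.
  have iDfin : (\int[mu]_y (D y)%:E)%E \is a fin_num.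
    exact: integrable_fin_num.
  rewrite -(fineK iDfin); congr EFin; apply/eqP.
  rewrite eq_le fine_ge0 ?andbT; last first.
    by apply: integral_ge0 => y _; rewrite lee_fin.
  have -> : fine (\int[mu]_y (D y)%:E)%E =
      convolution BBM_kernel v b - convolution BBM_kernel v a.
    by rewrite /convolution -RintegralB//; exact: (integrable_BBM_kernelM _ M).
  by rewrite subr_le0.
have /ae_eq_integral_abs nD := measurable_int _ iD.
have {nD} nD := (nD mu measurableT).1 D0.
(* So far [D] vanishes only almost everywhere. Off [a, b] the kernel difference is nonzero, so the
   points there with [v y != 0] form a negligible set; being open, it is empty. *)
have oU : open ([set y | v y != 0] `&` ~` [set` `[a, b]]).
  apply: openI; last exact/closed_openC/itv_closed.
  apply: (open_comp (f := v) (D := [set z | z != 0])); last exact: open_neq.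
  by move=> y _; exact: cv.
have : [set y | v y != 0] `&` ~` [set` `[a, b]] = set0.
  apply: negligible_open_empty => //.
  apply: negligibleS nD => y [/= vy yab] /(_ I)/eqP.
  rewrite eqe /D -mulrBl mulf_eq0 (negbTE vy) orbF subr_eq0 => /eqP Kab.
  have := BBM_kernel_lt a b y ab; rewrite Kab ltxx => H.
  by apply/notF/H/out/negP; move: yab; rewrite in_itv.
move=> U0 x; apply/eqP/negPn/negP => vx.
have : ([set y | v y != 0] `&` ~` [set` `[a, b]]) x.
  by split=> //=; rewrite in_itv/= => /vab/eqP; rewrite (negbTE vx).
by rewrite U0.
Qed.

Lemma continuous_half_square (g : R -> R) : continuous g ->
  continuous (fun y => (g y + 1) ^+ 2 / 2).
Proof.
move=> cg y; apply: cvgM; last exact: cvg_cst.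
apply: (@cvg_comp _ _ _ (fun y => g y + 1) (fun z => z ^+ 2)).
  by apply: cvgD; [exact: cg|exact: cvg_cst].
exact: exprn_continuous.
Qed.

Lemma half_square_bounds (x M : R) : `|x| <= M ->
  0 <= (x + 1) ^+ 2 / 2 <= (M + 1) ^+ 2 / 2.
Proof.
move=> xM; rewrite divr_ge0 ?sqr_ge0//= ler_pM2r ?invr_gt0//.
rewrite -[leLHS]real_normK ?num_real// ler_sqr ?nnegrE//; last first.
  by rewrite addr_ge0// (le_trans _ xM).
by rewrite (le_trans (ler_normD _ _))// normr1 lerD2r.
Qed.

(** Completing the square leaves the constant -1/2, which K annihilates. The new density is
    nonnegative and vanishes exactly where [g] is -1. *)
Lemma convolution_BBM_kernel_square (g : R -> R) (M x : R) : continuous g ->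
  (forall y, `|g y| <= M) ->
  convolution BBM_kernel (fun y => g y + g y ^+ 2 / 2) x =
  convolution BBM_kernel (fun y => (g y + 1) ^+ 2 / 2) x.
Proof.
move=> cg gM.
have csq := continuous_half_square g cg.
have sqM y : `|(g y + 1) ^+ 2 / 2| <= (M + 1) ^+ 2 / 2.
  by have /andP[ge0 leM] := half_square_bounds _ _ (gM y); rewrite ger0_norm.
rewrite /convolution (@eq_Rintegral _ _ _ _ _ (fun y : measurableTypeR R =>
    BBM_kernel (x - y) * ((g y + 1) ^+ 2 / 2) - BBM_kernel (x - y) * 2^-1)).
  rewrite RintegralB//.
  - rewrite RintegralZr ?Rintegral_BBM_kernel ?mul0r ?subr0//.
    exact: integrable_BBM_kernel.
  - exact: (integrable_BBM_kernelM _ ((M + 1) ^+ 2 / 2)).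
  - apply: (integrable_BBM_kernelM _ (2^-1)); first by move=> ?; exact: cvg_cst.
    by move=> _; rewrite ger0_norm.
by move=> y _ /=; field.
Qed.

End unique_continuation.

(** * Point evaluation on the Hölder space, and a mean value bound *)

Lemma class_C_continuous {R : realType} k (f : R -> R) :
  class_C k f -> continuous f.
Proof.
case: k => [|k] [df cf]//= x.
by apply: differentiable_continuous; apply/derivable1_diffP/(df 0%N).
Qed.

Section holder_space_eval.
Context {R : realType} {k : nat} {theta : R}.
Notation V := (holder_space k theta).

Lemma holder_spaceB (f g : V) x : (f - g) x = f x - g x.
Proof. by []. Qed.

(** The term of order 0 of the Hölder norm bounds evaluation, which is thus a continuous linear
    form. *)
Lemma ler_normr_holder (f : V) x : `|f x| <= `|f|.
Proof.
rewrite -lee_fin holder_normrE.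
exact: le_trans (ler_supnorm f x) (le_supnorm_holder_norm theta f (leq0n k)).
Qed.

Lemma holder_continuous (f : V) : continuous (f : R -> R).
Proof. by have [/class_C_continuous] := holder_space_class f. Qed.

Lemma cvg_holder_eval {T : Type} {F : set_system T} {FF : Filter F}
    (u : T -> V) (l : V) x : u @ F --> l -> (fun s => u s x) @ F --> l x.
Proof.
move=> /cvgrPdist_lt ul; apply/cvgrPdist_lt => e /ul.
apply: filterS => s; apply: le_lt_trans.
by rewrite -holder_spaceB ler_normr_holder.
Qed.

(** The scalar difference quotients are the evaluations at [x] of those of [u], so norm convergence
    passes to them. *)
Lemma derivable_holder_eval (u : R -> V) t x :
  derivable u t 1 -> derivable (fun s => u s x) t 1.
Proof.
move=> /cvg_ex[l ul]; apply/cvg_ex; exists (l x).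
exact: cvg_holder_eval ul.
Qed.

End holder_space_eval.

(** The mean value theorem with unordered endpoints, to serve times before and after a given one
    alike. *)
Lemma ler_normr_derive1 {R : realType} (f : R -> R) (s t C : R) :
  (forall r, Num.min s t <= r <= Num.max s t ->
    derivable f r 1 /\ `|derive1 f r| <= C) ->
  `|f t - f s| <= C * `|t - s|.
Proof.
wlog st : s t / s <= t => [wlg|].
  have /orP[|ts] := le_total s t; first exact: wlg.
  by rewrite minC maxC distrC (distrC t); exact: wlg.
rewrite (min_idPl st) (max_idPr st) => df.
have [||r] := @MVT_segment R f (derive1 f) s t st.
- move=> r rst; rewrite derive1E; apply: DeriveDef => //.
  by have [] := df r; first by rewrite !ltW ?(itvP rst).
- by apply: derivable_within_continuous => r; rewrite in_itv/= => /df[].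
rewrite in_itv/= => /df[_ fC] ->.
by rewrite normrM ler_wpM2r.
Qed.

(** * Propagation in time of the constant state -1 *)

Section BBM_uniqueness.
Context {R : realType} {k : nat} {theta : R}.
Variables (T : R) (u0 : holder_space k theta) (u : R -> holder_space k theta).
Hypothesis hu : BBM_solution [set t | - T < t < T] u0 u.

Lemma BBM_derive1 t x : - T < t < T ->
  derive1 (fun s => u s x) t =
  - convolution BBM_kernel (fun y => (u t y + 1) ^+ 2 / 2) x.
Proof.
case: hu => _ _ eu tT; apply/eqP; rewrite -addr_eq0; apply/eqP.
rewrite -(convolution_BBM_kernel_square _ `|u t|); first exact: eu.
- exact: holder_continuous.
- by move=> y; exact: ler_normr_holder.
Qed.

Lemma BBM_derivable t x : - T < t < T -> derivable (fun s => u s x) t 1.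
Proof. by case: hu => du _ _ tT; apply/derivable_holder_eval/(du 0%N). Qed.

Lemma BBM_continuous t : - T < t < T -> {for t, continuous u}.
Proof.
case: hu => du _ _ tT.
exact/differentiable_continuous/derivable1_diffP/(du 0%N).
Qed.

(* Near t1, the bound |u + 1| <= e <= 1 improves to e/2: the time derivative is
   at most e^2/2. *)
Lemma BBM_eqN1_near t1 : - T < t1 < T -> (forall x, u t1 x = -1) ->
  \forall t \near t1, forall x, u t x = -1.
Proof.
move=> t1T ut1.
have nu : \forall t \near t1, `|u t1 - u t| < 1.
  by move/cvgrPdist_lt : (BBM_continuous t1 t1T); exact.
have nT : \forall t \near t1, - T < t < T.
  near=> t; apply/andP; split; near: t.
    by apply: lt_nbhsr; case/andP: t1T.
  by apply: lt_nbhsl; case/andP: t1T.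
have /nbhs_ballP[d /= d0 Pd] :
    nbhs t1 [set s | `|u t1 - u s| < 1 /\ - T < s < T] by exact: filterI nT.
(* A radius of at most 1 keeps the length factor in the mean value bound at most 1. *)
have {}Pd s : `|t1 - s| < Num.min d 1 -> `|u t1 - u s| < 1 /\ - T < s < T.
  by rewrite lt_min => /andP[sd _]; exact: Pd.
have uE s y : u s y + 1 = u s y - u t1 y by rewrite ut1 opprK.
(* The radius is the same for all [n], so a full neighbourhood remains as [n] tends to infinity. *)
have H n : forall s y, `|t1 - s| < Num.min d 1 -> `|u s y + 1| <= 2^-1 ^+ n.
  elim: n => [|n IH] s y sd.
    have [us _] := Pd s sd; rewrite expr0 distrC in us *.
    rewrite uE -holder_spaceB.
    exact: le_trans (ler_normr_holder _ _) (ltW us).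
  rewrite uE.
  apply: (le_trans (ler_normr_derive1 (fun r => u r y) t1 s (2^-1 ^+ n.+1) _)).
    (* Times between [t1] and [s] stay within the radius, so the induction hypothesis applies to
       them. *)
    move=> r rts; have rd : `|t1 - r| < Num.min d 1.
      apply: le_lt_trans sd; move: rts.
      case: (leP t1 s) => ts /andP[? ?]; first by rewrite !ler0_norm; lra.
      by rewrite !ger0_norm; lra.
    have [_ rT] := Pd r rd; split; first exact: BBM_derivable.
    rewrite (BBM_derive1 _ _ rT) normrN.
    apply: normr_convolution_BBM_kernel.
      exact/continuous_half_square/holder_continuous.
    move=> z; rewrite ger0_norm ?divr_ge0 ?sqr_ge0//.
    rewrite [leRHS]exprSr ler_pM2r ?invr_gt0//.
    rewrite -[leLHS]real_normK ?num_real// expr2.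
    rewrite -[leRHS]mulr1 ler_pM ?IH//.
    by rewrite (le_trans (IH _ _ rd))// exprn_ile1// invf_le1 ?ler1n.
  rewrite ler_piMr ?exprn_ge0 ?invr_ge0// distrC ltW//.
  by rewrite (lt_le_trans sd)// ge_min lexx orbT.
apply/nbhs_ballP; exists (Num.min d 1); first by rewrite /= lt_min d0/=.
move=> s /= sd x; apply/eqP; rewrite -subr_eq0 opprK -normr_le0.
have half_cvg0 : (fun n => 2^-1 ^+ n : R) @ \oo --> (0 : R).
  by apply: cvg_expr; rewrite ger0_norm ?invr_ge0// invf_lt1 ?ltr1n.
rewrite -(cvg_lim _ half_cvg0)//; apply: limr_ge.
  by apply/cvg_ex; exists 0.
by apply: nearW => n; exact: H.
Unshelve. all: by end_near. Qed.

Lemma BBM_eqN1 t0 : - T < t0 < T -> (forall x, u t0 x = -1) ->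
  forall t, - T < t < T -> forall x, u t x = -1.
Proof.
move=> t0T ut0 t tT x.
pose Z := [set s | - T < s < T /\ forall y, u s y = -1].
pose I := [set s : R | - T < s < T].
have ZE : Z = I; last by have [] : Z t by rewrite ZE.
have cI : connected I.
  apply/connected_intervalP => s r /= /andP[Ts sT] /andP[Tr rT] z /andP[sz zr].
  by apply/andP; split; [exact: lt_le_trans sz|exact: le_lt_trans rT].
(* A nonempty subset of the connected [I] that is relatively open and relatively closed is all of
   [I]. *)
apply: cI; first by exists t0.
- exists Z; last by apply/esym/setIidPr => s [].
  rewrite openE => s [sT us]; have nus := BBM_eqN1_near s sT us.
  have nT : \forall r \near s, - T < r < T.
    have /andP[Ts sT'] := sT.
    near=> r; apply/andP; split; near: r; [exact: lt_nbhsr|exact: lt_nbhsl].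
  by near=> r; split; near: r.
- exists (closure Z); first exact: closed_closure.
  apply/seteqP; split => [s Zs|s [sT cZ]].
    by split; [case: Zs|exact: subset_closure].
  (* If [u s y] differed from -1, so would [u r y] for all [r] near [s], yet [Z] meets every
     neighbourhood of [s]. *)
  split=> // y; apply/eqP/negPn/negP => usy.
  have cuy : {for s, continuous (fun r => u r y)}.
    by apply: cvg_holder_eval; exact: BBM_continuous.
  have : nbhs s [set r | u r y != -1].
    by apply: (cuy [set z | z != -1]); apply: open_nbhs_nbhs; split => //;
      exact: open_neq.
  by move=> /cZ[r [[_ ur] /=]]; rewrite ur eqxx.
Unshelve. all: by end_near. Qed.

End BBM_uniqueness.

Theorem theorem1p3 (R : realType) (k : nat) (theta : R)
    (htheta : 0 <= theta <= 1) (u0 : holder_space k theta)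
    (T : R) (hT : 0 < T) (u : R -> holder_space k theta)
    (hu : BBM_solution [set t | - T < t < T] u0 u)
    (t0 : R) (ht0 : - T < t0 < T) (a b : R) (hab : a < b)
    (hi : forall x, a < x < b -> u t0 x = -1)
    (hii : derive1 (fun t => u t b) t0 >= derive1 (fun t => u t a) t0) :
  forall x t, - T < t < T -> u t x = -1.
Proof.
have v0 := eq0_convolution_BBM_kernel a b ((`|u t0| + 1) ^+ 2 / 2)
  (fun y => (u t0 y + 1) ^+ 2 / 2) hab
  (continuous_half_square _ (holder_continuous _))
  (fun y => half_square_bounds _ _ (ler_normr_holder (u t0) y)).
have ut0 x : u t0 x = -1.
  have /eqP : (u t0 x + 1) ^+ 2 / 2 = 0.
    apply: v0 => [y /hi->|]; first by rewrite addNr expr0n/= mul0r.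
    (* The time derivative is minus the convolution, so (ii) turns into the reverse inequality
       between the convolutions. *)
    by move: hii; rewrite !(BBM_derive1 _ _ _ hu)// lerN2.
  by rewrite mulf_eq0 invr_eq0 pnatr_eq0 orbF sqrf_eq0 addr_eq0 => /eqP.
by move=> x t tT; exact: BBM_eqN1 hu t0 ht0 ut0 t tT x.
Qed.
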